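(* Let $l\in L^2([0,T],\mathbb{R}^n)$ and $l_0,\ldots,l_M\in\mathbb{R}^n$, and let $(\lambda,\lambda_0)\in L^2([0,T],\mathbb{R}^n)\times\mathbb{R}^n$ satisfy $$\langle \mathcal{A}^*(\lambda,\lambda_0),\varphi\rangle_{H^1([0,T],\mathbb{R}^n)^*,H^1([0,T],\mathbb{R}^n)} = \langle l,\varphi\rangle_{L^2([0,T],\mathbb{R}^n)}+\sum_{i=0}^M l_i^\top\varphi(t_i)\qquad\text{for all }\varphi\in H^1([0,T],\mathbb{R}^n).$$ Then, with the value of $\lambda$ at $0$ taken to be $\lambda(0):=\lambda_0$: 1. $\lambda\in H^1_{\mathcal{T}}([0,T],\mathbb{R}^n)$ with $-\dot\lambda-A^\top\lambda=l$ (almost everywhere) on $\mathbb{I}_i$ for all $1\le i\le M$; 2. $\lambda^+(0)=\lambda_0-l_0$ and $\lambda^-(T)=l_M$; 3. $[\lambda]_i=-l_i$ for all $0\le i\le M-1$.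
   Context: Let $T>0$, $n\in\mathbb{N}$, and $A:=(J-R)Q$, where $J,R,Q\in\mathbb{R}^{n\times n}$ satisfy $J=-J^\top$, $R=R^\top\ge 0$, $Q=Q^\top\ge 0$ (positive semidefinite). $H^1([0,T],\mathbb{R}^n)$ is the Sobolev space of weakly differentiable functions, identified with their continuous representatives. The bounded linear operator $\mathcal{A}:H^1([0,T],\mathbb{R}^n)\to L^2([0,T],\mathbb{R}^n)\times\mathbb{R}^n$ (the latter space identified with its dual) is defined by $$\langle\mathcal{A}x,(\varphi,\varphi_0)\rangle_{L^2([0,T],\mathbb{R}^n)\times\mathbb{R}^n}:=\int_0^T\langle\dot x(t)-Ax(t),\varphi(t)\rangle\,\mathrm{d}t+\langle x(0),\varphi_0\rangle$$ for all $(\varphi,\varphi_0)\in L^2([0,T],\mathbb{R}^n)\times\mathbb{R}^n$. Its adjoint $\mathcal{A}^*:L^2([0,T],\mathbb{R}^n)\times\mathbb{R}^n\to H^1([0,T],\mathbb{R}^n)^*$ is given by $$\langle\mathcal{A}^*(\lambda,\lambda_0),x\rangle_{H^1([0,T],\mathbb{R}^n)^*,H^1([0,T],\mathbb{R}^n)}=\langle\mathcal{A}x,(\lambda,\lambda_0)\rangle_{L^2([0,T],\mathbb{R}^n)\times\mathbb{R}^n}.$$ Time grid: $M\in\mathbb{N}$ and $\mathcal{T}=\{t_0,\ldots,t_M\}$ with $0=t_0<t_1<\ldots<t_M=T$, and cells $\mathbb{I}_i=(t_{i-1},t_i]$ for $1\le i\le M$. The space of piecewise weakly differentiable functions is $$H^1_{\mathcal{T}}([0,T],\mathbb{R}^n):=\{v\in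 L^2([0,T],\mathbb{R}^n)\mid v|_{\mathbb{I}_i}\in H^1(\mathbb{I}_i,\mathbb{R}^n)\ \forall\,1\le i\le M,\ v(0)\in\mathbb{R}^n\},$$ i.e. an element consists of a function that is $H^1$ on each cell together with a separately assigned value $v(0)\in\mathbb{R}^n$ at $t=0$ (the point $0$ belongs to no cell). For $\lambda\in H^1_{\mathcal{T}}([0,T],\mathbb{R}^n)$ the one-sided limits (of the piecewise continuous representative) are $\lambda^-(t_i):=\lim_{t\to0^+}\lambda(t_i-t)$ for $0<i\le M$, $\lambda^+(t_i):=\lim_{t\to0^+}\lambda(t_i+t)$ for $0\le i<M$, and $\lambda^-(0):=\lambda(0)$. The jumps are $[\lambda]_i:=\lambda^+(t_i)-\lambda^-(t_i)$ for $0\le i\le M-1$. *)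

(* Defs.v *)
From HB Require Import structures.
From mathcomp Require Import all_boot all_order all_algebra.
From mathcomp Require Import all_classical all_reals all_analysis.
Set Implicit Arguments.
Unset Strict Implicit.
Unset Printing Implicit Defensive.
Import Order.TTheory GRing.Theory Num.Theory.
Import numFieldNormedType.Exports.
Local Open Scope classical_set_scope.
Local Open Scope ring_scope.

Definition dotp (R : realType) (n : nat) (u v : 'cV[R]_n) : R :=
  (u^T *m v) 0 0.

Definition psd (R : realType) (n : nat) (P : 'M[R]_n) : Prop :=
  P = P^T /\ forall v : 'cV[R]_n, 0 <= dotp v (P *m v).

(* Elements of L^2(D, R^n) are given by representatives; the values of [f]
   off [D] play no role, because [g \_ D] replaces them by 0. *)
Definition L2 (R : realType) (n : nat) (D : set R) (f : R -> 'cV[R]_n) : Prop :=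
  forall i : 'I_n,
    (fun s : R => f s i 0) \_ D \in Lfun (@lebesgue_measure R) 2%:E.

Definition L2ip (R : realType) (n : nat) (D : set R)
    (f g : R -> 'cV[R]_n) : R :=
  \int[@lebesgue_measure R]_(s in D) dotp (f s) (g s).

(* C_c^oo of the interior of D *)
Definition test_function (R : realType) (D : set R) (eta : R -> R) : Prop :=
  let supp := closure [set s | eta s != 0] in
  [/\ forall (k : nat) (s : R), derivable (derive1n k eta) s 1,
      compact supp & supp `<=` D°].

Definition is_weak_derivative (R : realType) (n : nat) (D : set R)
    (x dx : R -> 'cV[R]_n) : Prop :=
  forall eta : R -> R, test_function D eta -> forall i : 'I_n,
    \int[@lebesgue_measure R]_(s in D) (x s i 0 * derive1 eta s)
    = - \int[@lebesgue_measure R]_(s in D) (dx s i 0 * eta s).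

(* [x] is the continuous representative of an element of H^1(D, R^n), and [dx]
   represents its weak derivative. *)
Definition in_H1 (R : realType) (n : nat) (D : set R)
    (x dx : R -> 'cV[R]_n) : Prop :=
  [/\ L2 D x, L2 D dx, is_weak_derivative D x dx & {within D, continuous x}].

(* The weak derivative is determined by the function up to a null set; a
   representative of it is carried along so that it can be named. *)
Record H1 (R : realType) (n : nat) (D : set R) := MkH1 {
  H1_fun :> R -> 'cV[R]_n;
  H1_der : R -> 'cV[R]_n;
  H1P : in_H1 D H1_fun H1_der }.

Definition L2xRn_ip (R : realType) (n : nat) (T : R)
    (u v : (R -> 'cV[R]_n) * 'cV[R]_n) : R :=
  L2ip `[0, T] u.1 v.1 + dotp u.2 v.2.

Definition calA (R : realType) (n : nat) (A : 'M[R]_n) (T : R)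
    (x : H1 n `[0, T]) : (R -> 'cV[R]_n) * 'cV[R]_n :=
  (fun s => H1_der x s - A *m x s, x 0).

Definition calA_adj (R : realType) (n : nat) (A : 'M[R]_n) (T : R)
    (u : (R -> 'cV[R]_n) * 'cV[R]_n) : H1 n `[0, T] -> R :=
  fun x => L2xRn_ip T (calA A x) u.

(* Only [t 0, ..., t M] matter. *)
Definition time_grid (R : realType) (T : R) (M : nat) (t : nat -> R) : Prop :=
  [/\ t 0%N = 0, t M = T & forall i : nat, (i < M)%N -> t i < t i.+1].

(* used for 1 <= i <= M *)
Definition cell (R : realType) (t : nat -> R) (i : nat) : set R :=
  `]t i.-1, t i].

(* [v] is the representative of an element of H^1_T that is continuous on every
   cell, and its value at 0 is the separately assigned one; [dv] is the cellwise
   weak derivative. *)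
Definition in_H1_grid (R : realType) (n : nat) (M : nat) (t : nat -> R)
    (v dv : R -> 'cV[R]_n) : Prop :=
  L2 `[t 0%N, t M] v /\
  forall i : nat, (1 <= i <= M)%N -> in_H1 (cell t i) v dv.

Definition limit_right (R : realType) (n : nat) (t : nat -> R)
    (v : R -> 'cV[R]_n) (i : nat) : 'cV[R]_n :=
  lim (v s @[s --> (t i)^'+]).

Definition limit_left (R : realType) (n : nat) (t : nat -> R)
    (v : R -> 'cV[R]_n) (i : nat) : 'cV[R]_n :=
  if i is 0%N then v 0 else lim (v s @[s --> (t i)^'-]).

Definition jump (R : realType) (n : nat) (t : nat -> R)
    (v : R -> 'cV[R]_n) (i : nat) : 'cV[R]_n :=
  limit_right t v i - limit_left t v i.

(* Main.v *)
Require Import Defs.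
From HB Require Import structures.
From mathcomp Require Import all_boot all_order all_algebra.
From mathcomp Require Import all_classical all_reals all_analysis.
From mathcomp Require Import measurable_realfun ring lra.
Set Implicit Arguments.
Unset Strict Implicit.
Unset Printing Implicit Defensive.
Import Order.TTheory GRing.Theory Num.Theory.
Import numFieldNormedType.Exports.
Local Open Scope classical_set_scope.
Local Open Scope ring_scope.

(* The costate must be the explicit function
     m(s) = int_s^T (A^T lambda + l) + sum_{i >= 1, s <= t_i} l_i   (s > 0).
   Fix a coordinate j.  For psi in L^2, testing the adjoint equation with
   phi(s) = (c + int_0^s psi) e_j and exchanging the order of integration
   (Fubini) gives, for c = 0, int psi (lambda_j - m_j) = 0; the choice
   psi = lambda_j - m_j shows lambda = m almost everywhere.  Taking psi = 0 and
   c = 1 identifies m(0+) with lambda_0 - l_0.  On a cell the sum is constant,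
   so m is there a primitive of - A^T lambda - l, and its jumps and one-sided
   limits can be read off the formula.  The same Fubini identity, applied to the
   derivative of a test function, shows that primitives of integrable functions
   are weakly differentiable. *)

Section costate_theory.
Context {R : realType}.
Notation mu := (@lebesgue_measure R).
Implicit Types (f g eta : R -> R) (s : R).

(** * Primitives of integrable functions and the exchange of integrals *)

Definition primitive f s := \int[mu]_(r in `]-oo, s]) f r.

(** Continuity is local: to the right of [s - 1] the primitive is the constant [primitive f (s - 1)]
    plus an integral over a bounded interval, whose continuity in the upper end is known. *)
Lemma primitive_continuous f : mu.-integrable setT (EFin \o f) ->
  continuous (primitive f).
Proof.
move=> intf s.
have intS A : measurable A -> mu.-integrable A (EFin \o f).
  by move=> mA; exact: integrableS intf.
have ab : s - 1 < s + 1 by lra.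
have cint := parameterized_integral_continuous (ltW ab)
  (intS _ (measurable_itv _)).
have sab : s \in `](s - 1), (s + 1)[ by rewrite in_itv/=; apply/andP; split; lra.
have {}cint : {for s, continuous (fun x =>
    primitive f (s - 1) + parameterized_integral mu (s - 1) x f)}.
  apply: cvgD; first exact: cvg_cst.
  exact: (within_continuous_continuous ab cint sab).
rewrite /continuous_at.
have E x : s - 1 < x ->
    primitive f x = primitive f (s - 1) + parameterized_integral mu (s - 1) x f.
  move=> sx; rewrite /primitive /parameterized_integral.
  have /= := @Rintegral_itvB R f -oo%O (BRight x) (s - 1) (intS _ (measurable_itv _)).
  move=> /(_ isT (ltW sx)) H.
  by rewrite -Rintegral_itv_obnd_cbnd; [rewrite -H addrC subrK|exact: intS].
rewrite (E s); last lra.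
apply: cvg_trans cint; apply: near_eq_cvg; near=> x.
apply/esym/E; near: x; apply: lt_nbhsr; lra.
Unshelve. all: by end_near. Qed.

Lemma le_normr_primitive f s : mu.-integrable setT (EFin \o f) ->
  `|primitive f s| <= \int[mu]_r `|f r|.
Proof.
move=> intf; have intS A : measurable A -> mu.-integrable A (EFin \o f).
  by move=> mA; exact: integrableS intf.
apply: le_trans (le_normr_Rintegral _ (intS _ (measurable_itv _))) _ => //.
have intn : mu.-integrable setT (EFin \o (fun r => `|f r|)) by exact: integrable_norm.
rewrite /Rintegral fine_le//.
- by apply: integrable_fin_num => //; apply: integrableS intn.
- by apply: integrable_fin_num.
- apply: ge0_subset_integral => //; first exact: measurable_int intn.
Qed.

Lemma EFin_Rintegral (D : set R) f : measurable D -> mu.-integrable D (EFin \o f) ->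
  (\int[mu]_(r in D) f r)%:E = (\int[mu]_(r in D) (f r)%:E)%E.
Proof. by move=> mD intf; rewrite /Rintegral fineK// integrable_fin_num. Qed.

Lemma primitive_mkcond f s :
  primitive f s = \int[mu]_r (f r * (r <= s)%R%:R).
Proof.
rewrite /primitive Rintegral_mkcond; apply: eq_Rintegral => r _.
by rewrite patchE mem_setE in_itv/=; case: ifP; rewrite ?mulr1 ?mulr0.
Qed.

(** The null point [s] is included on purpose: with the closed condition, the same indicator
    describes the inner integrals in both orders of integration. *)
Lemma Rintegral_sub_primitive f s : mu.-integrable setT (EFin \o f) ->
  \int[mu]_r f r - primitive f s = \int[mu]_r (f r * (s <= r)%R%:R).
Proof.
move=> intf; have intS A : measurable A -> mu.-integrable A (EFin \o f).
  by move=> mA; exact: integrableS intf.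
have := @Rintegral_itvB R f -oo%O +oo%O s.
rewrite set_itvNyy => /(_ intf isT isT) ->.
rewrite Rintegral_itv_obnd_cbnd; last exact: intS.
rewrite Rintegral_mkcond; apply: eq_Rintegral => r _.
by rewrite patchE mem_setE in_itv/= andbT; case: ifP; rewrite ?mulr1 ?mulr0.
Qed.

(** Fubini for [f r * g s] on the half-plane [r <= s]. The inner integral of [g] over [s >= r] is
    left as total minus primitive, the shape in which the costate is defined. *)
Lemma Rintegral_primitive_mul f g :
  mu.-integrable setT (EFin \o f) -> mu.-integrable setT (EFin \o g) ->
  \int[mu]_s (primitive f s * g s)
  = \int[mu]_r (f r * (\int[mu]_s g s - primitive g r)).
Proof.
move=> intf intg.
pose k (p : R * R) := f p.2 * g p.1 * (p.2 <= p.1)%R%:R.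
have mf : measurable_fun setT f by apply/measurable_EFinP; exact: measurable_int intf.
have mg : measurable_fun setT g by apply/measurable_EFinP; exact: measurable_int intg.
have mbool (d : measure_display) (U : measurableType d) (a b : U -> R) :
    measurable_fun setT a -> measurable_fun setT b ->
    measurable_fun setT (fun x => (a x <= b x)%R%:R : R).
  move=> ma mb; apply: (@measurableT_comp _ _ _ _ _ _ (fun c : bool => c%:R : R)) => //.
  exact: measurable_fun_ler.
have mk : measurable_fun setT k.
  apply: measurable_funM; last exact: mbool.
  apply: measurable_funM; first by apply: measurableT_comp.
  by apply: measurableT_comp.
have bool1 (b : bool) : `|b%:R : R| <= 1 by rewrite ger0_norm// lern1 leq_b1.
have intM (h b : R -> R) : mu.-integrable setT (EFin \o h) ->
    measurable_fun setT h -> measurable_fun setT b ->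
    (forall x, `|b x| <= 1) -> mu.-integrable setT (EFin \o (h \* b)).
  move=> inth mh mb b1; apply: le_integrable inth => //.
    by apply/measurable_EFinP; apply: measurable_funM.
  by move=> r _ /=; rewrite lee_fin normrM ler_piMr.
have intA s : mu.-integrable setT (EFin \o (fun r => f r * (r <= s)%R%:R)).
  by apply: (intM f (fun r => (r <= s)%R%:R)) => //; exact: mbool.
have intB r : mu.-integrable setT (EFin \o (fun s => g s * (r <= s)%R%:R)).
  by apply: (intM g (fun s => (r <= s)%R%:R)) => //; exact: mbool.
(* By Tonelli: the kernel is dominated by [|f r| * |g s|], whose double integral is a product of two
   finite integrals. *)
have intk : (mu \x mu)%E.-integrable setT (EFin \o k).
  apply/integrable12ltyP; first exact/measurable_EFinP.
  apply: (@le_lt_trans _ _ (\int[mu]_s ((\int[mu]_r `|f r|%:E) * `|g s|%:E))%E).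
    apply: ge0_le_integral => //.
    - by move=> s _; exact: integral_ge0.
    - apply: (measurable_fun_fubini_tonelli_F (m2 := mu) (abse \o (EFin \o k))) => //=.
      by apply: measurableT_comp => //; exact/measurable_EFinP.
    - apply: measurable_funeM; apply/measurable_EFinP; exact: measurableT_comp.
    - move=> s _; rewrite -ge0_integralZr//; last 1 first.
        by apply/measurable_EFinP; exact: measurableT_comp.
      apply: ge0_le_integral => //.
      + apply/measurable_EFinP; apply: measurableT_comp => //.
        apply: (measurableT_comp mk); exact: measurable_pair1.
      + apply/measurable_EFinP; apply: measurable_funM => //; exact: measurableT_comp.
      + by move=> r _; rewrite /= lee_fin /k/= 2!normrM ler_piMr.
  move/integrableP: intf => [_ intf]; move/integrableP: intg => [_ intg].
  rewrite ge0_integralZl//; last 2 first.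
    by apply/measurable_EFinP; exact: measurableT_comp.
    exact: integral_ge0.
  by rewrite lte_mul_pinfty// ?integral_ge0// ge0_fin_numE ?integral_ge0.
rewrite /Rintegral; congr fine.
transitivity (\int[mu]_s \int[mu]_r (EFin \o k) (s, r))%E.
  apply: eq_integral => s _.
  rewrite primitive_mkcond EFinM EFin_Rintegral//.
  rewrite -integralZr//; last exact: intA.
  apply: eq_integral => r _.
  by rewrite -EFinM /k/= mulrAC.
rewrite (Fubini intk).
apply: eq_integral => r _.
rewrite Rintegral_sub_primitive// EFinM EFin_Rintegral//.
rewrite -integralZl//; last exact: intB.
apply: eq_integral => s _.
by rewrite -EFinM /k/= mulrA.
Qed.

(** Functions on an interval are extended by 0, so a primitive started at minus infinity is in
    effect started at [a]. *)
Lemma primitive_patch_left f a b :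
  mu.-integrable setT (EFin \o (f \_ `[a, b])) ->
  primitive (f \_ `[a, b]) a = 0.
Proof.
move=> intf; rewrite /primitive -Rintegral_itv_bndo_bndc; last exact: integrableS intf.
rewrite (@eq_Rintegral _ _ _ mu _ (cst 0)); first by rewrite Rintegral_cst// mul0r.
move=> s; rewrite inE/= in_itv/= => s0; rewrite patchE memNset//= in_itv/=.
by rewrite leNgt s0.
Qed.

Lemma primitive_patch_right f a b :
  mu.-integrable setT (EFin \o (f \_ `[a, b])) ->
  primitive (f \_ `[a, b]) b = \int[mu]_s (f \_ `[a, b]) s.
Proof.
move=> intf; apply/esym/eqP; rewrite -subr_eq0 /primitive -set_itvNyy.
rewrite Rintegral_itvB//; last by rewrite set_itvNyy.
rewrite (@eq_Rintegral _ _ _ mu _ (cst 0)); first by rewrite Rintegral_cst// mul0r.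
move=> s; rewrite inE/= in_itv/= andbT => s0; rewrite patchE memNset//= in_itv/=.
by rewrite andbC leNgt s0.
Qed.

Lemma primitiveN f s : mu.-integrable setT (EFin \o f) ->
  primitive (fun r => - f r) s = - primitive f s.
Proof.
move=> intf; rewrite /primitive -mulN1r -RintegralZl//; last exact: integrableS intf.
by apply: eq_Rintegral => r _; rewrite mulN1r.
Qed.

Lemma integrable_mul_bounded f g (K : R) : mu.-integrable setT (EFin \o f) ->
  measurable_fun setT g -> (forall s, `|g s| <= K) ->
  mu.-integrable setT (EFin \o (fun s => f s * g s)).
Proof.
move=> intf mg gK.
have mf : measurable_fun setT f by apply/measurable_EFinP; exact: measurable_int intf.
have intKf : mu.-integrable setT (fun s => K%:E * (f s)%:E)%E by exact: integrableZl.
apply: le_integrable intKf => //.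
  by apply/measurable_EFinP; exact: measurable_funM.
move=> s _; rewrite -EFinM/= lee_fin !normrM mulrC ler_wpM2r//.
exact: le_trans (gK s) (ler_norm _).
Qed.

Lemma derivable_continuous (f : R -> R) : (forall s, derivable f s 1) -> continuous f.
Proof.
by move=> df s; apply/differentiable_continuous/derivable1_diffP.
Qed.

(** * Test functions and weak derivatives of primitives *)

Section test_function.
Variables (D : set R) (eta : R -> R).
Hypothesis teta : test_function D eta.

Let supp := closure [set s | eta s != 0].

Let eta_supp s : ~ supp s -> eta s = 0.
Proof.
by move=> ns; apply: contrapT => /eqP es; apply: ns; exact: subset_closure.
Qed.

(** The support is closed, so off it [eta] vanishes on a whole neighbourhood and has the derivative
    of 0. *)
Let deta_supp s : ~ supp s -> derive1 eta s = 0.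
Proof.
move=> ns; rewrite derive1E (@near_eq_derive _ _ _ _ (cst 0)); first exact: derive_cst.
have : open (~` supp) by rewrite openC; exact: closed_closure.
rewrite openE => /(_ s ns); rewrite /interior/= => H; near=> x.
by apply: eta_supp; near: x.
Unshelve. all: by end_near. Qed.

Lemma test_function_out s : ~ D s -> eta s = 0 /\ derive1 eta s = 0.
Proof.
case: teta => _ _ sD Ds; have ns : ~ supp s by move=> /sD/interior_subset.
by split; [exact: eta_supp|exact: deta_supp].
Qed.

Lemma test_function_continuous : continuous eta.
Proof. by case: teta => d _ _; apply: derivable_continuous => s; exact: (d 0%N). Qed.

Lemma test_function_derive1_continuous : continuous (derive1 eta).
Proof. by case: teta => d _ _; apply: derivable_continuous => s; exact: (d 1%N). Qed.

Let supp_bounded : exists2 K, 0 < K & forall s, K <= `|s| -> ~ supp s.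
Proof.
case: teta => _ cs _; have [M [_ HM]] := compact_bounded cs.
have M0 : M < `|M| + 1 by rewrite (le_lt_trans (ler_norm _))// ltrDl.
(* Any number above [M], such as [|M| + 1], bounds the support; one more unit makes the exclusion
   strict. *)
exists (`|M| + 2); first by rewrite ltr_wpDl.
move=> s Ms /(HM _ M0)/=; lra.
Qed.

Lemma test_function_derive1_integrable : mu.-integrable setT (EFin \o derive1 eta).
Proof.
have [K K0 KP] := supp_bounded.
have -> : derive1 eta = (derive1 eta) \_ `[- K, K].
  apply/funext => s; rewrite patchE; case: ifPn => //; rewrite mem_setE in_itv/= => sK.
  apply/deta_supp/KP; move: sK; rewrite negb_and -!ltNge => /orP[] H.
    by rewrite ltr0_norm; lra.
  by rewrite gtr0_norm; lra.
rewrite -restrict_EFin; apply/integrable_restrict => //=; rewrite setTI.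
apply: continuous_compact_integrable; first exact: segment_compact.
exact/continuous_subspaceT/test_function_derive1_continuous.
Qed.

(** The derivative vanishes to the left of the support, so the integral may start at a point where
    [eta] is 0, and the fundamental theorem of calculus applies on a compact interval. *)
Lemma primitive_derive1_test_function s : primitive (derive1 eta) s = eta s.
Proof.
have [K K0 KP] := supp_bounded.
have intd := test_function_derive1_integrable.
have intS A : measurable A -> mu.-integrable A (EFin \o derive1 eta).
  by move=> mA; exact: integrableS intd.
(* A starting point to the left of both [s] and the support. *)
pose a := Num.min s (- K) - 1.
have [as_ aK] : a < s /\ a < - K.
  have : Num.min s (- K) <= s by rewrite ge_min lexx.
  have : Num.min s (- K) <= - K by rewrite ge_min lexx orbT.
  by rewrite /a; split; lra.
have Kout r : r <= a -> K <= `|r| by move=> ra; rewrite ltr0_norm; lra.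
have := @Rintegral_itvB R (derive1 eta) -oo%O (BRight s) a
  (intS _ (measurable_itv _)) isT (ltW as_).
rewrite -[\int[mu]_(t in _) _]/(primitive _ _) => /eqP; rewrite subr_eq => /eqP ->.
rewrite [X in _ + X](_ : _ = 0); last first.
  transitivity (\int[mu]_(r in `]-oo, a]) (cst 0 r : R)).
    apply: eq_Rintegral => r; rewrite inE/= in_itv/= => ra.
    by apply/deta_supp/KP/Kout.
  by rewrite Rintegral_cst// mul0r.
rewrite addr0 Rintegral_itv_obnd_cbnd; last exact: intS.
rewrite /Rintegral (@continuous_FTC2 _ _ eta)//=.
- by rewrite (eta_supp (KP _ (Kout _ (lexx _)))) subr0.
- exact/continuous_subspaceT/test_function_derive1_continuous.
- split; [|exact/cvg_at_right_filter/test_function_continuous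
          |exact/cvg_at_left_filter/test_function_continuous].
  by move=> x _; case: teta => d _ _; exact: (d 0%N).
Qed.

Lemma Rintegral_derive1_test_function : \int[mu]_s derive1 eta s = 0.
Proof.
have [K K0 KP] := supp_bounded.
(* At [K], beyond the support, the primitive is [eta K = 0], and the remaining integral over
   [r >= K] vanishes as well. *)
have := Rintegral_sub_primitive K test_function_derive1_integrable.
rewrite primitive_derive1_test_function eta_supp; last by apply: KP; exact: ler_norm.
rewrite subr0 => ->; transitivity (\int[mu]_r (cst 0 r : R)).
  apply: eq_Rintegral => r _; have [Kr|_] := leP K r; last by rewrite mulr0.
  by rewrite deta_supp ?mul0r//; apply: KP; rewrite (le_trans Kr)// ler_norm.
by rewrite Rintegral_cst// mul0r.
Qed.

Lemma test_function_integrable_mul f : mu.-integrable setT (EFin \o f) ->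
  mu.-integrable setT (EFin \o (fun s => f s * eta s)).
Proof.
(* As the primitive of its derivative, [eta] is bounded by the integral of [|eta'|]. *)
move=> intf; apply: (integrable_mul_bounded (K := \int[mu]_r `|derive1 eta r|)) => //.
  by apply: continuous_measurable_fun; exact: test_function_continuous.
move=> s; rewrite -primitive_derive1_test_function.
exact/le_normr_primitive/test_function_derive1_integrable.
Qed.

(** Since [eta] and its derivative vanish off [D], both integrals extend to the line. There [c]
    drops out because [eta'] has integral 0, and Fubini replaces the primitive of [f] against [eta']
    by [f] against [0 - eta]. *)
Lemma weak_derivative_primitive f c : mu.-integrable setT (EFin \o f) ->
  \int[mu]_(s in D) ((c + primitive f s) * derive1 eta s)
  = - \int[mu]_(s in D) (f s * eta s).
Proof.
move=> intf; have intd := test_function_derive1_integrable.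
have patch_mul : (fun s => f s * eta s) \_ D = (fun s => f s * eta s).
  apply/funext => s; rewrite patchE; case: ifPn => //.
  by rewrite notin_setE => /test_function_out[-> _]; rewrite mulr0.
rewrite [LHS]Rintegral_mkcond [in RHS]Rintegral_mkcond patch_mul.
transitivity (\int[mu]_s (c * derive1 eta s + primitive f s * derive1 eta s)).
  apply: eq_Rintegral => s _; rewrite -mulrDl patchE; case: ifPn => //.
  by rewrite notin_setE => /test_function_out[_ ->]; rewrite mulr0.
rewrite RintegralD//; last 2 first.
- exact: (integrableZl _ _ intd).
- have : mu.-integrable setT (EFin \o (fun s => derive1 eta s * primitive f s)).
    apply: (integrable_mul_bounded (K := \int[mu]_r `|f r|)) => //.
      by apply: continuous_measurable_fun; exact: primitive_continuous.
    by move=> s; exact: le_normr_primitive.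
  by under [in X in X -> _]eq_fun do rewrite mulrC.
rewrite RintegralZl// Rintegral_derive1_test_function mulr0 add0r.
rewrite Rintegral_primitive_mul// Rintegral_derive1_test_function.
rewrite -mulN1r -RintegralZl//; last exact: test_function_integrable_mul.
apply: eq_Rintegral => s _.
by rewrite primitive_derive1_test_function sub0r mulrN mulN1r.
Qed.

End test_function.

(** * Square-integrable functions on a set of finite measure *)

Lemma Lfun2_sqr_integrable (f : R -> R) : measurable_fun setT f ->
  mu.-integrable setT (EFin \o (fun s => f s ^+ 2)) -> f \in Lfun mu 2%:E.
Proof.
move=> mf /integrableP[mf2 intf]; rewrite inE; apply/andP; split; rewrite inE//=.
rewrite /finite_norm unlock /Lnorm poweR_lty//.
apply: (le_lt_trans _ intf); apply: ge0_le_integral => //=.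
- apply/measurable_EFinP; apply: (measurableT_comp (measurable_powR _)) => //.
  exact: measurableT_comp.
- by apply/measurable_EFinP; apply: measurableT_comp => //; exact: measurable_funX.
- by move=> s _; rewrite lee_fin powR_mulrn// normrX.
Qed.

Section L2.
Variable D : set R.
Hypotheses (mD : measurable D) (finD : (mu D < +oo)%E).

Lemma Lfun2_bounded f K : measurable_fun setT f -> (forall s, D s -> `|f s| <= K) ->
  f \_ D \in Lfun mu 2%:E.
Proof.
move=> mf fK.
have mfD : measurable_fun setT (f \_ D).
  by apply/measurable_restrict => //; rewrite setTI; exact: measurable_funTS.
apply: Lfun2_sqr_integrable => //.
have intK : mu.-integrable setT (EFin \o ((cst (K ^+ 2)) \_ D)).
  rewrite -restrict_EFin; apply/integrable_restrict => //=; rewrite setTI.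
  apply/integrableP; split; first by apply/measurable_EFinP; exact: measurable_cst.
  rewrite (_ : (fun _ => _) = cst `|K ^+ 2|%:E)//.
  by rewrite integral_cst//= lte_mul_pinfty.
apply: le_integrable intK => //.
  by apply/measurable_EFinP; exact: measurable_funX.
move=> s _; rewrite /= lee_fin !patchE; case: ifPn => [|_]; last by rewrite expr0n.
rewrite inE => /fK {}fK; rewrite !normrX lerXn2r ?nnegrE//.
by rewrite (le_trans fK) ?ler_norm.
Qed.

Lemma Lfun2_integrable_mul f g : f \_ D \in Lfun mu 2%:E -> g \_ D \in Lfun mu 2%:E ->
  mu.-integrable setT (EFin \o ((fun s => f s * g s) \_ D)).
Proof.
move=> f2 g2; have /Lfun1_integrable := Lfun2_mul_Lfun1 f2 g2.
congr (mu.-integrable setT (EFin \o _)); apply/funext => s /=.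
by rewrite !patchE; case: ifPn => // _; rewrite mulr0.
Qed.

(** Hölder against the constant 1, which is square integrable because [D] has finite measure. *)
Lemma Lfun2_integrable f : f \_ D \in Lfun mu 2%:E ->
  mu.-integrable setT (EFin \o (f \_ D)).
Proof.
move=> f2; have c2 : (cst (1 : R)) \_ D \in Lfun mu 2%:E.
  by apply: (@Lfun2_bounded _ 1); [exact: measurable_cst|move=> s _; rewrite normr1].
have := Lfun2_integrable_mul f2 c2.
congr (mu.-integrable setT (EFin \o _)); apply/funext => s /=.
by rewrite !patchE mulr1.
Qed.

Lemma Lfun2_0 : (cst (0 : R)) \_ D \in Lfun mu 2%:E.
Proof.
apply: (@Lfun2_bounded _ 0); first exact: measurable_cst.
by move=> s _; rewrite normr0.
Qed.

Lemma Lfun2_linear f g a : f \_ D \in Lfun mu 2%:E -> g \_ D \in Lfun mu 2%:E ->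
  (fun s => a * f s + g s) \_ D \in Lfun mu 2%:E.
Proof.
move=> f2 g2; have [_ H] := Lfun_submod_closed mu (lee1n 2 : (1 <= 2%:E :> \bar R)%E).
rewrite (_ : _ \_ D = a *: (f \_ D) + g \_ D); first exact: H.
apply/funext => s; rewrite [RHS]/(a * (f \_ D) s + (g \_ D) s).
by rewrite !patchE; case: ifPn => //= _; exact/esym/(etrans (addr0 _) (mulr0 _)).
Qed.

Lemma Rintegral_sqr_eq0 f : f \_ D \in Lfun mu 2%:E ->
  \int[mu]_(s in D) (f s * f s) = 0 -> {ae mu, forall s, D s -> f s = 0}.
Proof.
move=> f2 f0.
have intff : mu.-integrable D (EFin \o (fun s => f s * f s)).
  have := Lfun2_integrable_mul f2 f2.
  by rewrite -restrict_EFin => /integrable_restrict; rewrite setTI; exact.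
have : (\int[mu]_(s in D) `|(f s * f s)%:E|)%E = 0%E.
  transitivity ((\int[mu]_(s in D) (f s * f s))%:E); last by rewrite f0.
  rewrite EFin_Rintegral//; apply: eq_integral => s _.
  by rewrite gee0_abs// lee_fin -expr2 sqr_ge0.
have mff := measurable_int _ intff.
move=> /(ae_eq_integral_abs mu mD mff); apply: filterS => s /= ff /ff[] /eqP.
by rewrite mulf_eq0 orbb => /eqP.
Qed.
End L2.

(** * The explicit costate in one coordinate *)

Section costate.
Variables (T : R) (M : nat) (t : nat -> R).
Hypothesis tT : time_grid T M t.
Variables (h : R -> R) (L : nat -> R).
Notation D := (`[0, T]%classic : set R).

(** The function [m] of the overview, with [h] a coordinate of [A^T lambda + l]. The closed
    condition [s <= t i] makes it left-continuous at the grid points, in accordance with cells that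
    contain their right end. The weight [L 0] is absent: it acts at time 0 and enters only through
    the initial value. *)
Definition costate s := \int[mu]_r (h \_ D) r - primitive (h \_ D) s
  + \sum_(1 <= i < M.+1) L i * (s <= t i)%R%:R.

Hypothesis h2 : h \_ D \in Lfun mu 2%:E.

Let mD : measurable D. Proof. exact: measurable_itv. Qed.

Let finD : (mu D < +oo)%E.
Proof. by rewrite /= lebesgue_measure_itv; case: ifP => //=; rewrite ?ltry. Qed.

Let hI : mu.-integrable setT (EFin \o (h \_ D)).
Proof. exact: Lfun2_integrable. Qed.

Lemma measurable_costate : measurable_fun setT costate.
Proof.
apply: measurable_funD.
  apply: measurable_funB; first exact: measurable_cst.
  by apply: continuous_measurable_fun; exact: primitive_continuous.
apply: measurable_sum => i; apply: measurable_funM; first exact: measurable_cst.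
apply: (@measurableT_comp _ _ _ _ _ _ (fun c : bool => c%:R : R)) => //.
by apply: measurable_fun_ler.
Qed.

Lemma le_normr_costate s : `|costate s| <= `|\int[mu]_r (h \_ D) r| +
  \int[mu]_r `|(h \_ D) r| + \sum_(1 <= i < M.+1) `|L i|.
Proof.
rewrite /costate (le_trans (ler_normD _ _))// lerD//.
  by rewrite (le_trans (ler_normB _ _))// lerD2l le_normr_primitive.
rewrite (le_trans (ler_norm_sum _ _ _))// ler_sum// => i _.
by rewrite normrM ler_piMr// ger0_norm// lern1 leq_b1.
Qed.

Lemma costate_Lfun2 : costate \_ D \in Lfun mu 2%:E.
Proof.
by apply: (Lfun2_bounded mD finD measurable_costate) => s _; exact: le_normr_costate.
Qed.

Variables (f : R -> R) (f0 : R).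
Hypothesis f2 : f \_ D \in Lfun mu 2%:E.
(** The adjoint equation tested with [c] plus the primitive of [psi] in one coordinate. The term
    with [A] has been absorbed into [h], and [c * f0] is the initial value of the test state paired
    with [lambda_0]. *)
Hypothesis adj : forall c psi, psi \_ D \in Lfun mu 2%:E ->
  \int[mu]_(s in D) (psi s * f s)
  = \int[mu]_(s in D) ((c + primitive (psi \_ D) s) * h s)
    + \sum_(i < M.+1) L i * (c + primitive (psi \_ D) (t i)) - c * f0.

(** The left side is the value of the costate just after 0. It is found with the constant test state
    1, that is [psi = 0] and [c = 1]. *)
Lemma costate_initial :
  \int[mu]_r (h \_ D) r + \sum_(1 <= i < M.+1) L i = f0 - L 0%N.
Proof.
have c0 : (cst (0 : R)) \_ D = cst (0 : R).
  by apply/funext => s; rewrite patchE; case: ifP.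
have z2 : (cst (0 : R)) \_ D \in Lfun mu 2%:E.
  exact: Lfun2_0.
have P0 s : primitive (cst (0 : R)) s = 0 by rewrite /primitive Rintegral_cst// mul0r.
have := adj 1 z2; rewrite c0.
rewrite (@eq_Rintegral _ _ _ mu D (cst 0)); last by move=> s _; rewrite /= mul0r.
rewrite Rintegral_cst// mul0r.
rewrite (@eq_Rintegral _ _ _ mu D h); last by move=> s _; rewrite P0 addr0 mul1r.
rewrite Rintegral_mkcond.
rewrite (eq_bigr (fun i : 'I_M.+1 => L i)); last by move=> i _; rewrite P0 addr0 mulr1.
rewrite -(big_mkord predT) big_ltn//= mul1r; lra.
Qed.

Lemma costate_ae : {ae mu, forall s, D s -> costate s = f s}.
Proof.
(* The difference [f - costate], written in the form that [Lfun2_linear] accepts. *)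
pose psi s := (-1) * costate s + f s.
have psi2 : psi \_ D \in Lfun mu 2%:E by apply: Lfun2_linear => //; exact: costate_Lfun2.
have psiI : mu.-integrable setT (EFin \o (psi \_ D)) by exact: Lfun2_integrable.
suff : \int[mu]_(s in D) (psi s * psi s) = 0.
  move=> /(Rintegral_sqr_eq0 mD psi2) psi0.
  apply: (@filterS _ _ (ae_filter_ringOfSetsType mu) _ _ _ psi0) => s /[apply].
  by rewrite /psi mulN1r addrC => /eqP; rewrite subr_eq0 => /eqP.
have intS f1 f2' : f1 \_ D \in Lfun mu 2%:E -> f2' \_ D \in Lfun mu 2%:E ->
    mu.-integrable D (EFin \o (fun s => f1 s * f2' s)).
  move=> f12 f22; have := Lfun2_integrable_mul f12 f22.
  by rewrite -restrict_EFin => /integrable_restrict; rewrite setTI; exact.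
(* It remains to see that the two integrals agree: the equation rewrites the first, and Fubini turns
   the result into the second. *)
transitivity (\int[mu]_(s in D) (psi s * f s) - \int[mu]_(s in D) (psi s * costate s)).
  rewrite -RintegralB//; [|exact: intS|exact/intS/costate_Lfun2].
  by apply: eq_Rintegral => s _; rewrite [X in _ * X]/psi; ring.
apply/eqP; rewrite subr_eq0; apply/eqP.
rewrite (adj 0 psi2) mul0r subr0.
have -> : \int[mu]_(s in D) ((0 + primitive (psi \_ D) s) * h s) =
    \int[mu]_s ((psi \_ D) s * (\int[mu]_r (h \_ D) r - primitive (h \_ D) s)).
  rewrite -Rintegral_primitive_mul// Rintegral_mkcond; apply: eq_Rintegral => s _.
  rewrite !patchE; case: ifP => /= _; first by rewrite add0r.
  exact/esym/mulr0.
have boolM (r : seq nat) :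
    measurable_fun setT (fun s => \sum_(i <- r) L i * (s <= t i)%R%:R).
  apply: measurable_sum => i; apply: measurable_funM; first exact: measurable_cst.
  apply: (@measurableT_comp _ _ _ _ _ _ (fun c : bool => c%:R : R)) => //.
  exact: measurable_fun_ler.
have sumI (r : seq nat) : mu.-integrable setT (EFin \o
    (fun s => (psi \_ D) s * \sum_(i <- r) L i * (s <= t i)%R%:R)).
  apply: (integrable_mul_bounded (K := \sum_(i <- r) `|L i|)) => //.
  move=> s; rewrite (le_trans (ler_norm_sum _ _ _))// ler_sum// => i _.
  by rewrite normrM ler_piMr// ger0_norm// lern1 leq_b1.
have boolI i : mu.-integrable setT (EFin \o (fun s => (psi \_ D) s * (s <= t i)%R%:R)).
  apply: (integrable_mul_bounded (K := 1)) => //.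
    apply: (@measurableT_comp _ _ _ _ _ _ (fun c : bool => c%:R : R)) => //.
    exact: measurable_fun_ler.
  by move=> s; rewrite ger0_norm// lern1 leq_b1.
(* Evaluating the primitive at [t i] amounts to integrating [psi] against the indicator of
   [s <= t i]; this yields the step part of the costate. *)
have sumE (r : seq nat) : \int[mu]_s ((psi \_ D) s * \sum_(i <- r) L i * (s <= t i)%R%:R)
    = \sum_(i <- r) L i * primitive (psi \_ D) (t i).
  elim: r => [|i r IHr].
    rewrite big_nil (@eq_Rintegral _ _ _ mu _ (cst 0)); last first.
      by move=> s _; rewrite big_nil mulr0.
    by rewrite Rintegral_cst// mul0r.
  rewrite big_cons -IHr primitive_mkcond -RintegralZl//.
  rewrite -RintegralD//; last exact: (integrableZl _ _ (boolI i)).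
  by apply: eq_Rintegral => s _; rewrite big_cons; ring.
(* With [c = 0] the test state vanishes at [t 0 = 0], which removes the summand of index 0. *)
have P0 : primitive (psi \_ D) 0 = 0 by exact: primitive_patch_left.
rewrite -(big_mkord predT (fun i => L i * (0 + primitive (psi \_ D) (t i)))) big_ltn//=.
case: tT => -> _ _; rewrite P0 addr0 mulr0 add0r.
under eq_bigr do rewrite add0r.
rewrite -sumE -RintegralD//; last first.
  apply: (integrable_mul_bounded
    (K := `|\int[mu]_r (h \_ D) r| + \int[mu]_r `|(h \_ D) r|)) => //.
    apply: measurable_funB; first exact: measurable_cst.
    by apply: continuous_measurable_fun; exact: primitive_continuous.
  by move=> s; rewrite (le_trans (ler_normB _ _))// lerD2l le_normr_primitive.
rewrite [RHS]Rintegral_mkcond; apply: eq_Rintegral => s _.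
rewrite -mulrDr !patchE; case: ifP => //= _.
exact: mul0r.
Qed.
End costate.

(** * Vector-valued functions and the test states *)

Lemma mx_continuous m p (F : R -> 'M[R]_(m, p)) :
  (forall i j, continuous (fun s => F s i j)) -> continuous F.
Proof.
move=> cF s; apply/cvg_mx_entourageP => V entV.
suff : \forall r \near s, forall i j, (F s i j, F r i j) \in V by [].
apply: (@filter_forall _ _
  (fun i r => forall j, (F s i j, F r i j) \in V) (nbhs s) _) => i.
apply: (@filter_forall _ _ (fun j r => (F s i j, F r i j) \in V) (nbhs s) _) => j.
have := cF i j s; rewrite /continuous_at => /cvg_entourageP/(_ _ entV).
by apply: (@filterS _ (nbhs s) _) => r; rewrite /xsection/= inE.
Qed.

Lemma L2_subset n (D E : set R) (v : R -> 'cV[R]_n) : measurable D -> measurable E ->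
  E `<=` D -> L2 D v -> L2 E v.
Proof.
move=> mD mE ED v2 i; have vi := v2 i.
have patchED : (fun s => v s i 0) \_ E = ((fun s => v s i 0) \_ D) \_ E.
  apply/funext => s; rewrite !patchE; case: ifPn => //; rewrite inE => /ED Ds.
  by rewrite mem_set.
have mvD : measurable_fun setT ((fun s => v s i 0) \_ D).
  by have /andP[+ _] := vi; rewrite inE.
apply: Lfun2_sqr_integrable.
  rewrite patchED; apply/measurable_restrict => //; rewrite setTI.
  exact: measurable_funTS.
have := Lfun2_integrable_sqr vi; set w := (_ \_ D) => intw.
have -> : (fun s => ((fun s => v s i 0) \_ E) s ^+ 2) = (fun s => w s ^+ 2) \_ E.
  apply/funext => s; rewrite patchED -/w !patchE; case: ifPn => // _.
  exact: expr0n.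
rewrite -restrict_EFin; apply/integrable_restrict => //; rewrite setTI.
exact: integrableS intw.
Qed.

Lemma L2_mulmx n (D : set R) (B : 'M[R]_n) (v : R -> 'cV[R]_n) : measurable D ->
  (mu D < +oo)%E -> L2 D v -> L2 D (fun s => B *m v s).
Proof.
move=> mD finD v2 i.
under [X in X \_ D]eq_fun do rewrite mxE.
elim: (index_enum _) => [|k r IHr].
  under [X in X \_ D]eq_fun do rewrite big_nil.
  exact: Lfun2_0.
under [X in X \_ D]eq_fun do rewrite big_cons.
exact: Lfun2_linear.
Qed.

Lemma L2D n (D : set R) (v w : R -> 'cV[R]_n) : L2 D v -> L2 D w ->
  L2 D (fun s => v s + w s).
Proof.
move=> v2 w2 i; rewrite [X in X \_ D](_ : _ = fun s => 1 * v s i 0 + w s i 0).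
  exact: Lfun2_linear.
by apply/funext => s; rewrite mxE mul1r.
Qed.

Lemma L2N n (D : set R) (v : R -> 'cV[R]_n) : measurable D ->
  (mu D < +oo)%E -> L2 D v -> L2 D (fun s => - v s).
Proof.
move=> mD finD v2 i; rewrite [X in X \_ D](_ : _ = fun s => (-1) * v s i 0 + cst 0 s).
  apply: Lfun2_linear => //.
  exact: Lfun2_0.
by apply/funext => s; rewrite mxE mulN1r addr0.
Qed.

(** This supplies the test states: one coordinate with an arbitrary initial value and an arbitrary
    square-integrable derivative, the others zero. *)
Lemma in_H1_primitive n (T : R) c (psi : R -> R) (j : 'I_n) :
  psi \_ `[0, T] \in Lfun mu 2%:E ->
  in_H1 `[0, T] (fun s => (c + primitive (psi \_ `[0, T]) s) *: delta_mx j 0)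
    (fun s => psi s *: (delta_mx j 0 : 'cV[R]_n)).
Proof.
move=> psi2; set D := (`[0, T]%classic : set R).
have mD : measurable D by exact: measurable_itv.
have finD : (mu D < +oo)%E.
  by rewrite /D/= lebesgue_measure_itv; case: ifP => //=; rewrite ?ltry.
have intp : mu.-integrable setT (EFin \o (psi \_ D)) by exact: Lfun2_integrable.
have z2 : (cst (0 : R)) \_ D \in Lfun mu 2%:E.
  exact: Lfun2_0.
have cp : continuous (fun s => c + primitive (psi \_ D) s).
  by move=> s; apply: cvgD; [exact: cvg_cst|exact: primitive_continuous].
(* A coordinate as a linear combination, so that [Lfun2_linear] covers [i = j] and [i != j]
   together. *)
have coord (x : R -> R) (i : 'I_n) :
    (fun s => (x s *: (delta_mx j 0 : 'cV[R]_n)) i 0) = (fun s => (i == j)%:R * x s + 0).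
  by apply/funext => s; rewrite !mxE eqxx andbT mulrC addr0.
split.
- move=> i; rewrite coord; apply: Lfun2_linear => //.
  apply: (Lfun2_bounded mD finD (K := `|c| + \int[mu]_s `|(psi \_ D) s|)).
    exact: continuous_measurable_fun.
  by move=> s _; rewrite (le_trans (ler_normD _ _))// lerD2l le_normr_primitive.
- by move=> i; rewrite coord; exact: Lfun2_linear.
- move=> eta teta i.
  have [->|ij] := eqVneq i j; last first.
    have H (x y : R -> R) :
        \int[mu]_(s in D) ((x s *: (delta_mx j 0 : 'cV[R]_n)) i 0 * y s) = 0.
      rewrite (@eq_Rintegral _ _ _ mu _ (cst 0)); first by rewrite Rintegral_cst// mul0r.
      by move=> s _; rewrite !mxE (negbTE ij) /= mulr0 mul0r.
    by rewrite !H oppr0.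
  transitivity (\int[mu]_(s in D) ((c + primitive (psi \_ D) s) * derive1 eta s)).
    by apply: eq_Rintegral => s _; rewrite !mxE !eqxx/= mulr1.
  rewrite (weak_derivative_primitive teta)//; congr (- _).
  by apply: eq_Rintegral => s Ds; rewrite !mxE !eqxx/= mulr1 patchE Ds.
- apply: continuous_subspaceT => s; apply: cvgZr_tmp; exact: cp.
Qed.

(** * The time grid and the continuous pieces of the costate *)

Section time_grid.
Variables (T : R) (M : nat) (t : nat -> R).
Hypothesis tT : time_grid T M t.

Lemma time_grid_le i k : (i <= k <= M)%N -> t i <= t k.
Proof.
case: tT => _ _ tlt /andP[]; elim: k => [|k IHk].
  by rewrite leqn0 => /eqP->.
rewrite leq_eqVlt => /predU1P[->//|ik] kM.
by rewrite (le_trans (IHk _ (ltnW kM)))// ltW// tlt.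
Qed.

Lemma cell_subset i : (1 <= i <= M)%N -> cell t i `<=` `[0, T].
Proof.
case: tT => t0 tM _ /andP[i1 iM] s; rewrite /cell/= !in_itv/= => /andP[is_ si].
rewrite -t0 -tM (le_trans _ (ltW is_)) ?(le_trans si)// time_grid_le//.
  by rewrite iM leqnn.
by rewrite /= (leq_trans (leq_pred _)).
Qed.

(** Half-open cells make this exact: the indicators in the costate are constant on each cell, right
    end included. *)
Lemma cell_le_grid i k s : (1 <= i <= M)%N -> (k <= M)%N -> cell t i s ->
  (s <= t k) = (i <= k)%N.
Proof.
move=> /andP[i1 iM] kM; rewrite /cell/= in_itv/= => /andP[is_ si].
have [ik|ki] := leqP i k; first by rewrite (le_trans si)// time_grid_le// ik.
apply/negbTE; rewrite -ltNge (le_lt_trans _ is_)// time_grid_le//.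
by rewrite -ltnS prednK// ki (leq_trans (leq_pred _)).
Qed.

(** The formula of the costate on cell [i], extended continuously to the whole line; one-sided
    limits at grid points thus become plain values of pieces. *)
Definition costate_piece (h : R -> R) (L : nat -> R) i s :=
  \int[mu]_r (h \_ `[0, T]) r - primitive (h \_ `[0, T]) s
  + \sum_(1 <= k < M.+1) L k * (i <= k)%N%:R.

Lemma costate_cell h L i s : (1 <= i <= M)%N -> cell t i s ->
  costate T M t h L s = costate_piece h L i s.
Proof.
move=> iM cs; rewrite /costate /costate_piece; congr (_ + _).
apply: eq_big_nat => k /andP[_ kM].
by rewrite (cell_le_grid iM)//.
Qed.

(** Consecutive pieces differ only in the summand [k = i], which the later piece has lost. *)
Lemma costate_piece_jump h L i s : (1 <= i <= M)%N ->
  costate_piece h L i.+1 s - costate_piece h L i s = - L i.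
Proof.
move=> /andP[i1 iM]; rewrite /costate_piece [LHS](_ : _ =
  \sum_(1 <= k < M.+1) (L k * (i < k)%N%:R - L k * (i <= k)%N%:R)); last first.
  by rewrite sumrB; ring.
rewrite (bigD1_seq i)/= ?iota_uniq//; last by rewrite mem_index_iota i1.
rewrite ltnn leqnn mulr0 mulr1 sub0r big1 ?addr0// => k ki.
by rewrite ltn_neqAle eq_sym ki/= subrr.
Qed.

Lemma costate_piece_continuous h L i :
  mu.-integrable setT (EFin \o (h \_ `[0, T])) -> continuous (costate_piece h L i).
Proof.
move=> hI s; apply: cvgD; last exact: cvg_cst.
by apply: cvgB; [exact: cvg_cst|exact: primitive_continuous].
Qed.

End time_grid.

(** * The adjoint equation in coordinates *)

Lemma dotpC n (u v : 'cV[R]_n) : dotp u v = dotp v u.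
Proof. by rewrite /dotp -[in LHS](trmxK v) -trmx_mul mxE. Qed.

Lemma dotpBl n (u v w : 'cV[R]_n) : dotp (u - v) w = dotp u w - dotp v w.
Proof. by rewrite /dotp linearB/= mulmxBl !mxE. Qed.

Lemma dotp_mulmxl n (B : 'M[R]_n) (u v : 'cV[R]_n) : dotp (B *m u) v = dotp u (B^T *m v).
Proof. by rewrite /dotp trmx_mul mulmxA. Qed.

Lemma dotp_delta n (x : R) j (v : 'cV[R]_n) : dotp (x *: delta_mx j 0) v = x * v j 0.
Proof. by rewrite /dotp linearZ/= -scalemxAl mxE trmx_delta -rowE mxE. Qed.

(** This provides the hypothesis [adj] of the scalar theory: the equation is tested with a primitive
    in direction [j], and [A] is moved onto [lambda] by transposition. *)
Lemma calA_adj_coord n (T : R) (A : 'M[R]_n) M (t : nat -> R)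
    (l lambda : R -> 'cV[R]_n) (l_ : nat -> 'cV[R]_n) (lambda0 : 'cV[R]_n) :
  L2 `[0, T] l -> L2 `[0, T] lambda ->
  (forall phi : H1 n `[0, T], calA_adj A (lambda, lambda0) phi
     = L2ip `[0, T] l phi + \sum_(i < M.+1) dotp (l_ i) (phi (t i))) ->
  forall j c (psi : R -> R), psi \_ `[0, T] \in Lfun mu 2%:E ->
  \int[mu]_(s in `[0, T]) (psi s * lambda s j 0)
  = \int[mu]_(s in `[0, T])
      ((c + primitive (psi \_ `[0, T]) s) * (A^T *m lambda s + l s) j 0)
    + \sum_(i < M.+1) l_ i j 0 * (c + primitive (psi \_ `[0, T]) (t i))
    - c * lambda0 j 0.
Proof.
move=> hl hlambda hadj j c psi psi2.
have mD : measurable (`[0, T]%classic : set R) by exact: measurable_itv.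
have finD : (mu (`[0%R, T]%classic : set R) < +oo)%E.
  by rewrite /= lebesgue_measure_itv; case: ifP => //=; rewrite ?ltry.
have psiI := Lfun2_integrable mD finD psi2.
have phiH1 := in_H1_primitive c j psi2.
have := hadj (MkH1 phiH1).
set x := fun s => c + primitive (psi \_ `[0, T]) s in phiH1 *.
have x2 : x \_ `[0, T] \in Lfun mu 2%:E.
  apply: (Lfun2_bounded mD finD (K := `|c| + \int[mu]_s `|(psi \_ `[0, T]) s|)).
    apply: continuous_measurable_fun => s.
    by apply: cvgD; [exact: cvg_cst|exact: primitive_continuous].
  by move=> s _; rewrite (le_trans (ler_normD _ _))// lerD2l le_normr_primitive.
have intM (f g : R -> R) :
    f \_ `[0, T] \in Lfun mu 2%:E -> g \_ `[0, T] \in Lfun mu 2%:E ->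
    mu.-integrable `[0, T] (EFin \o (fun s => f s * g s)).
  move=> f2 g2; have := Lfun2_integrable_mul f2 g2.
  by rewrite -restrict_EFin => /integrable_restrict; rewrite setTI; exact.
have Al2 := L2_mulmx A^T mD finD hlambda.
rewrite /calA_adj /L2xRn_ip /L2ip /calA /= => E.
have {}E : \int[mu]_(s in `[0, T]) (psi s * lambda s j 0 - x s * (A^T *m lambda s) j 0)
    + c * lambda0 j 0
    = \int[mu]_(s in `[0, T]) (x s * l s j 0) + \sum_(i < M.+1) l_ i j 0 * x (t i).
  (* The test state starts at [c], because the primitive vanishes at 0. *)
  have -> : c * lambda0 j 0 = dotp (x 0 *: delta_mx j 0) lambda0.
    by rewrite dotp_delta /x primitive_patch_left ?addr0.
  transitivity (\int[mu]_(s in `[0, T]) (dotp (l s) (x s *: delta_mx j 0))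
      + \sum_(i < M.+1) dotp (l_ i) (x (t i) *: delta_mx j 0)).
    rewrite -E; congr (_ + _); apply: eq_Rintegral => s _.
    by rewrite dotpBl dotp_mulmxl !dotp_delta.
  congr (_ + _); first by apply: eq_Rintegral => s _; rewrite dotpC dotp_delta.
  by apply: eq_bigr => i _; rewrite dotpC dotp_delta mulrC.
move: E; rewrite RintegralB//; [|exact: intM|exact: intM].
have -> : \int[mu]_(s in `[0, T]) (x s * (A^T *m lambda s + l s) j 0) =
    \int[mu]_(s in `[0, T]) (x s * (A^T *m lambda s) j 0) +
    \int[mu]_(s in `[0, T]) (x s * l s j 0).
  rewrite -RintegralD//; [|exact: intM|exact: intM].
  by apply: eq_Rintegral => s _; rewrite mxE mulrDr.
lra.
Qed.

End costate_theory.

(** * Assembly over coordinates and cells *)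

Theorem lemma2 (R : realType) (n : nat) (T : R) (hT : 0 < T)
    (J Rm Q : 'M[R]_n) (hJ : J = - J^T) (hR : psd Rm) (hQ : psd Q)
    (A : 'M[R]_n) (hA : A = (J - Rm) *m Q)
    (M : nat) (t : nat -> R) (ht : time_grid T M t)
    (l : R -> 'cV[R]_n) (hl : L2 `[0, T] l) (l_ : nat -> 'cV[R]_n)
    (lambda : R -> 'cV[R]_n) (hlambda : L2 `[0, T] lambda)
    (lambda0 : 'cV[R]_n)
    (hadj : forall phi : H1 n `[0, T],
      calA_adj A (lambda, lambda0) phi
      = L2ip `[0, T] l phi + \sum_(i < M.+1) dotp (l_ i) (phi (t i))) :
  (* [mu] is the piecewise continuous representative of [lambda] *)
  exists mu dmu : R -> 'cV[R]_n,
    [/\ {ae (@lebesgue_measure R), forall s, `[0, T]%classic s ->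
           mu s = lambda s} /\ mu 0 = lambda0,
        in_H1_grid M t mu dmu /\
        (forall i : nat, (1 <= i <= M)%N ->
          {ae (@lebesgue_measure R), forall s, cell t i s ->
             - dmu s - A^T *m mu s = l s}),
        (forall i : nat, (i < M)%N -> cvg (mu s @[s --> (t i)^'+])) /\
        (forall i : nat, (1 <= i <= M)%N -> cvg (mu s @[s --> (t i)^'-])),
        limit_right t mu 0 = lambda0 - l_ 0%N /\ limit_left t mu M = l_ M
      & forall i : nat, (i < M)%N -> jump t mu i = - l_ i].
Proof.
have [t0 tM tlt] := ht.
(* Without a cell, [T = t 0 = 0]. *)
have M0 : (0 < M)%N by case: M t0 tM {ht hadj tlt} => // -> T0; rewrite T0 ltxx in hT.
set mu := @lebesgue_measure R.
have mD : measurable (`[0, T]%classic : set R) by exact: measurable_itv.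
have finD : (mu (`[0%R, T]%classic : set R) < +oo)%E.
  by rewrite /mu/= lebesgue_measure_itv; case: ifP => //=; rewrite ?ltry.
pose h j s := (A^T *m lambda s + l s) j 0; pose L j i := l_ i j 0.
have hv2 : L2 `[0, T] (fun s => A^T *m lambda s + l s).
  by apply: L2D => //; exact: L2_mulmx.
have h2 j : h j \_ `[0, T] \in Lfun mu 2%:E := hv2 j.
have hI j := Lfun2_integrable mD finD (h2 j).
have adj j := calA_adj_coord hl hlambda hadj j.
(* At 0 the costate formula gives [lambda0 - l_ 0], so the assigned value [lambda0] has to be put in
   by hand. *)
pose v s := if s <= 0 then lambda0 else \col_j costate T M t (h j) (L j) s.
(* Built from the given [lambda], so that it is exactly the integrand of the pieces; passing to [v]
   in the equation costs a null set. *)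
pose dv s := - (A^T *m lambda s + l s).
pose piece i s : 'cV[R]_n := \col_j costate_piece T M (h j) (L j) i s.
have mcell i : measurable (cell t i) by exact: measurable_itv.
have v_piece i s : (1 <= i <= M)%N -> cell t i s -> v s = piece i s.
  move=> iM cs; rewrite /v ifF; last first.
    apply/negbTE; rewrite -ltNge -t0; move: cs; rewrite /cell/= in_itv/= => /andP[+ _].
    apply: le_lt_trans; apply: (time_grid_le ht) => /=.
    by case/andP: iM => _; apply: leq_trans; exact: leq_pred.
  by apply/colP => j; rewrite !mxE (costate_cell ht _ _ iM cs).
have piece_cont i : continuous (piece i).
  apply: mx_continuous => j k.
  rewrite (_ : (fun _ => _) = costate_piece T M (h j) (L j) i).
    exact: costate_piece_continuous.
  by apply/funext => s; rewrite mxE.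
have v_lambda : {ae mu, forall s, `[0, T]%classic s -> v s = lambda s}.
  have aeF := ae_filter_ringOfSetsType mu.
  have : {ae mu, forall s, forall j, `[0, T]%classic s ->
      costate T M t (h j) (L j) s = lambda s j 0}.
    apply: filter_forall => j.
    exact: (costate_ae ht (h2 j) (hlambda j) (adj j)).
  (* The point 0 is discarded, since [v 0 = lambda0] is unrelated to the representative [lambda]. *)
  have : {ae mu, forall s, s != 0}.
    exists [set 0]; split => //; first exact: lebesgue_measure_set1.
    by move=> s /= /negP; rewrite negbK => /eqP.
  apply: filterS2 => s s0 cl Ds; rewrite /v ifF.
    by apply/colP => j; rewrite mxE cl.
  move: Ds; rewrite /= in_itv/= => /andP[]; rewrite le_eqVlt eq_sym (negbTE s0)/=.
  by rewrite ltNge => /negbTE.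
have v2 : L2 `[0, T] v.
  move=> j.
  rewrite [X in X \_ _](_ : _ = fun s => if s <= 0 then lambda0 j 0
      else costate T M t (h j) (L j) s); last first.
    by apply/funext => s; rewrite /v; case: ifP; rewrite ?mxE.
  have costate_le := le_normr_costate M t (L j) (h2 j).
  apply: (Lfun2_bounded mD finD (K := `|lambda0 j 0| + (`|\int[mu]_r (h j \_ `[0, T]) r| +
    \int[mu]_r `|(h j \_ `[0, T]) r| + \sum_(1 <= i < M.+1) `|L j i|))) => [|s _].
    apply: measurable_fun_ifT; last exact: measurable_costate.
      exact: measurable_fun_ler.
    exact: measurable_cst.
  case: ifP => _; last by rewrite (le_trans (costate_le s))// lerDr.
  by rewrite lerDl (le_trans _ (costate_le 0)).
(* Just after [t i] lies cell [i.+1], just before it cell [i]; hence the different pieces in the two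
   limits. *)
have right_lim i : (i < M)%N -> v s @[s --> (t i)^'+] --> piece i.+1 (t i).
  move=> iM; apply: cvg_trans (cvg_at_right_filter (piece_cont i.+1 (t i))).
  apply: near_eq_cvg; near=> s; apply/esym/v_piece => //.
  rewrite /cell/= in_itv/=; apply/andP; split; near: s; first exact: nbhs_right_gt.
  by apply: nbhs_right_le; exact: tlt.
have left_lim i : (1 <= i <= M)%N -> v s @[s --> (t i)^'-] --> piece i (t i).
  move=> iM.
  have tii : t i.-1 < t i.
    by case/andP: iM => i0 iM; rewrite -[in ltRHS](prednK i0) tlt// prednK.
  apply: cvg_trans (cvg_at_left_filter (piece_cont i (t i))).
  apply: near_eq_cvg; near=> s; apply/esym/v_piece => //.
  rewrite /cell/= in_itv/=; apply/andP; split; near: s; last exact: nbhs_left_le.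
  exact: nbhs_left_gt.
have limit_rightE i : (i < M)%N -> limit_right t v i = piece i.+1 (t i).
  by move=> iM; apply: norm_cvg_lim; exact: right_lim.
have limit_leftE i : (1 <= i <= M)%N -> limit_left t v i = piece i (t i).
  by case: i => // i iM; apply: norm_cvg_lim; exact: left_lim.
have v0 : v 0 = lambda0 by rewrite /v lexx.
have limit_right0 : limit_right t v 0 = lambda0 - l_ 0%N.
  rewrite limit_rightE// t0; apply/colP => j; rewrite !mxE /costate_piece.
  rewrite primitive_patch_left// subr0.
  rewrite -(costate_initial (L := L j) (adj j)); congr (_ + _).
  by apply: eq_big_nat => k /andP[k1 _]; rewrite k1 mulr1.
exists v, dv; split.
- by split.
- split.
    split; first by rewrite t0 tM.
    move=> i iM; have sub := cell_subset ht iM.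
    split.
    + exact: L2_subset sub v2.
    + by apply: (L2_subset mD _ sub) => //; exact: L2N.
    + move=> eta teta j.
      (* On the cell, coordinate [j] of [v] is this constant plus the primitive of [- h j]. *)
      pose c := \int[mu]_r (h j \_ `[0, T]) r +
        \sum_(1 <= k < M.+1) L j k * (i <= k)%N%:R.
      have hIN : mu.-integrable setT (EFin \o (fun s => - (h j \_ `[0, T]) s)).
        exact: (integrableN (hI j)).
      transitivity (\int[mu]_(s in cell t i)
          ((c + primitive (fun s => - (h j \_ `[0, T]) s) s) * derive1 eta s)).
        apply: eq_Rintegral => s; rewrite inE => cs; congr (_ * _).
        by rewrite (v_piece _ _ iM cs) mxE primitiveN// /costate_piece /c; ring.
      rewrite (weak_derivative_primitive teta)//; congr (- _).
      apply: eq_Rintegral => s; rewrite inE => cs; congr (_ * _).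
      rewrite patchE mem_set; last exact: sub.
      by rewrite /dv /h [RHS]mxE.
    + apply: (@subspace_eq_continuous _ _ _ (piece i)).
        by move=> s; rewrite inE => cs; apply/esym/v_piece.
      exact: continuous_subspaceT.
  move=> i iM.
  apply: (@filterS _ _ (ae_filter_ringOfSetsType mu) _ _ _ v_lambda) => s vl cs.
  by rewrite /dv vl ?opprK ?[A^T *m _ + _]addrC ?addrK//; exact: (cell_subset ht iM).
- split=> i iM; first by apply/cvg_ex; exists (piece i.+1 (t i)); exact: right_lim.
  by apply/cvg_ex; exists (piece i (t i)); exact: left_lim.
(* At [T] the tail integral is empty, and in the last piece only the summand [k = M] survives. *)
- split=> //; rewrite limit_leftE ?M0 ?leqnn// tM; apply/colP => j.
  rewrite mxE /costate_piece primitive_patch_right// subrr add0r.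
  rewrite big_nat_recr//= leqnn mulr1 big_nat_cond big1 ?add0r// => k.
  by rewrite andbT => /andP[_ kM]; rewrite leqNgt kM mulr0.
(* At index 0 the left limit is the assigned [lambda0], so the jump comes from the initial value; at
   the other indices it is a difference of consecutive pieces. *)
- case=> [|i] iM; first by rewrite /jump limit_right0 /limit_left v0 addrAC subrr sub0r.
  rewrite /jump limit_rightE// limit_leftE; last by rewrite /= ltnW.
  by apply/colP => j; rewrite !mxE costate_piece_jump//= ltnW.
Unshelve. all: by end_near. Qed.
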